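(* Let $\mathcal{M}$ be the set of irrationals $\alpha\in(0,1)$ such that the convergents $(a_j/q_j)_{j=0}^\infty$ of the continued fraction of $\alpha$ satisfy $$\log q_{j+1}=O\left(\frac{q_j}{\log q_j}\right).$$ If $\alpha\in(0,1)$ is an irrational not in $\mathcal{M}$, then $$\sum_{n=-\infty}^{+\infty}\frac{\log\big(1+\|\widetilde T_\alpha^n f\|\big)}{1+n^2}=+\infty$$ for any non-zero $f\in L^p[0,1)$, for $1\le p<\infty$.
   Context: $\{\cdot\}$ denotes the fractional part. For irrational $\alpha\in(0,1)$ the Bishop operator on $L^p[0,1)$ is $T_\alpha f(t)=t\,f(\{t+\alpha\})$, and $\widetilde T_\alpha=e\,T_\alpha$, where $e=\exp(1)$. On the space of (classes of) measurable functions on $[0,1)$, $\widetilde T_\alpha$ is a bijection with inverse $\widetilde T_\alpha^{-1}f(t)=e^{-1}f(\{t-\alpha\})/\{t-\alpha\}$. For $n>0$ and $f\in L^p[0,1)$, $\|\widetilde T_\alpha^{-n}f\|$ denotes the $L^p$ norm of the $n$-th backward iterate $\widetilde T_\alpha^{-n}f$ if it belongs to $L^p[0,1)$, and $\infty$ otherwise. The sum is understood in $[0,+\infty]$, with $\log(1+\infty)=\infty$. The $O$-condition means that there is a constant $K$ with $\log q_{j+1}\le Kq_j/\log q_j$ for all $j$ with $q_j\ge2$. Convergents are in lowest terms with $q_j\ge1$. *)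

(* Defs.v *)
From mathcomp Require Import all_boot all_order all_algebra.
From mathcomp Require Import complex.
From mathcomp Require Import all_classical all_reals all_analysis.

Set Implicit Arguments.
Unset Strict Implicit.
Unset Printing Implicit Defensive.

Import Order.TTheory GRing.Theory Num.Theory.
Import numFieldNormedType.Exports.

Local Open Scope classical_set_scope.
Local Open Scope ring_scope.
Local Open Scope complex_scope.

Definition frac_part (R : realType) (x : R) : R := x - (Num.floor x)%:~R.

(* For an irrational number the complete quotients are never integers, so that
   the inverse below is never taken at 0. *)
Definition complete_quotient (R : realType) (alpha : R) (j : nat) : R :=
  iter j (fun x => (frac_part x)^-1) alpha.

Definition partial_quotient (R : realType) (alpha : R) (j : nat) : int :=
  Num.floor (complete_quotient alpha j).

(* cf_eval c0 [:: c1; ...; cn] = c0 + 1 / (c1 + 1 / (... + 1 / cn)) *)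
Fixpoint cf_eval (c : int) (s : seq int) : rat :=
  if s is c' :: s' then c%:~R + (cf_eval c' s')^-1 else c%:~R.

Definition convergent (R : realType) (alpha : R) (j : nat) : rat :=
  cf_eval (partial_quotient alpha 0)
          [seq partial_quotient alpha i | i <- iota 1 j].

Definition convergent_den (R : realType) (alpha : R) (j : nat) : int :=
  denq (convergent alpha j).

Definition classM (R : realType) : set R :=
  [set alpha | [/\ irrational alpha, 0 < alpha < 1 &
    exists K : R, forall j : nat, (2 <= convergent_den alpha j)%R ->
      ln (convergent_den alpha j.+1)%:~R <=
        K * ((convergent_den alpha j)%:~R / ln (convergent_den alpha j)%:~R)]].

(* Elements of L^p[0,1) are complex valued and are given by representatives
   R -> R[i], whose values outside [0,1) play no role. *)
Definition Lp_norm (R : realType) (p : R) (f : R -> R[i]) : \bar R :=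
  Lnorm lebesgue_measure p%:E
    ((fun t => (Normc.normc (f t))%:E) \_ (`[0, 1[ : set R)).

Definition in_Lp (R : realType) (p : R) (f : R -> R[i]) : Prop :=
  [/\ measurable_fun (`[0, 1[ : set R) (fun t => complex.Re (f t)),
      measurable_fun (`[0, 1[ : set R) (fun t => complex.Im (f t)) &
      (Lp_norm p f < +oo)%E].

Definition Lp_zero (R : realType) (f : R -> R[i]) : Prop :=
  {ae lebesgue_measure, forall t : R, t \in `[0, 1[ -> f t = 0}.

Definition bishop (R : realType) (alpha : R) (f : R -> R[i]) : R -> R[i] :=
  fun t => t%:C * f (frac_part (t + alpha)).

Definition bishopt (R : realType) (alpha : R) (f : R -> R[i]) : R -> R[i] :=
  fun t => (expR 1)%:C * bishop alpha f t.

(* The value at the single point t = alpha, where the denominator vanishes, is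
   irrelevant. *)
Definition bishopt_inv (R : realType) (alpha : R) (f : R -> R[i]) :
    R -> R[i] :=
  fun t => ((expR 1)^-1)%:C * f (frac_part (t - alpha))
           / (frac_part (t - alpha))%:C.

(* Negz n is the integer - n.+1 *)
Definition bishopt_iter (R : realType) (alpha : R) (n : int)
    (f : R -> R[i]) : R -> R[i] :=
  match n with
  | Posz m => iter m (bishopt alpha) f
  | Negz m => iter m.+1 (bishopt_inv alpha) f
  end.

(* Main.v *)
Require Import Defs.
From mathcomp Require Import all_boot all_order all_algebra.
From mathcomp Require Import complex.
From mathcomp Require Import all_classical all_reals all_analysis.
From mathcomp Require Import measurable_realfun.
From mathcomp Require Import ring lra zify.

Import Order.TTheory GRing.Theory Num.Theory.
Import numFieldNormedType.Exports.

Local Open Scope classical_set_scope.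
Local Open Scope ring_scope.
Local Open Scope complex_scope.

(* Write W_n(t) = e^n prod_(j < n) {t + j alpha}, so that the n-th forward
   iterate of f is W_n(t) f({t + n alpha}) and the n-th backward iterate is
   f({t - n alpha}) / W_n({t - n alpha}).  If alpha is not in M, there are
   convergents a/q with |q alpha - a| <= 1/q' and ln q' > K q / ln q, for every K.
   As long as n = o(q'), the points {s + j alpha} in a block of q consecutive
   indices are tiny perturbations of (u + r)/q, r < q, where u = {q s}; by
   Stirling's formula the block contributes about (u - 1/2) ln q to ln W_n.
   Hence the forward iterates grow like exp (c n ln q / q) on {u > 1/2 + eps},
   and the backward ones on {u < 1/2 - eps}.  A fixed set of positive measure on
   which |f| is bounded below meets one of these two regions in measure bounded
   below, so the terms q^2 <= n <= eps q' / 4 of one sign contribute at least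
   c (ln q / q) (ln q' - O(ln q)) >= c K - O(1) to the sum. *)

(** * Continued fractions *)

(** The determinant condition is a Bezout relation, so the fraction is reduced. This identifies
    [convergent_den] with the denominators produced by the recursion below. *)
Lemma denq_unimodular (a b c d : int) :
  0 < b -> a * d - b * c = 1 \/ a * d - b * c = -1 -> denq (a%:~R / b%:~R) = b.
Proof.
move=> b0 det; rewrite coprimeq_den; last first.
  rewrite -[coprime _ _]/(coprimez a b); apply/coprimezP.
  by case: det => det; [exists (d, - c)|exists (- d, c)] => /=; lia.
by rewrite gt_eqF// gtr0_norm.
Qed.

Lemma frac_part_bounds (R : realType) (x : R) : 0 <= frac_part x < 1.
Proof.
by rewrite /frac_part subr_ge0 floor_le ltrBlDr addrC -intrD1 floorD1_gt.
Qed.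

Lemma frac_partDz (R : realType) (x : R) (n : int) :
  frac_part (x + n%:~R) = frac_part x.
Proof. by rewrite /frac_part floorDrz ?intr_int// intrKfloor intrD; ring. Qed.

Lemma frac_part_small (R : realType) (x : R) : 0 <= x < 1 -> frac_part x = x.
Proof.
move=> x01; rewrite /frac_part (_ : Num.floor x = 0) ?subr0//.
by apply: floor_def; rewrite add0r.
Qed.

Lemma frac_part_irrational_gt0 (R : realType) (x : R) :
  irrational x -> 0 < frac_part x.
Proof.
move=> ix; have /andP[h _] := frac_part_bounds R x.
rewrite lt_neqAle h andbT; apply/eqP => f0; apply: ix.
exists (Num.floor x)%:~R => //; rewrite ratr_int.
by apply/eqP; rewrite -subr_eq0 -opprB oppr_eq0 -/(frac_part x) -f0.
Qed.

Lemma irrational_frac_partV (R : realType) (x : R) :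
  irrational x -> irrational (frac_part x)^-1.
Proof.
move=> ix [r _ rE]; apply: ix; exists ((Num.floor x)%:~R + r^-1) => //.
by rewrite rmorphD/= ratr_int fmorphV/= rE invrK /frac_part addrC subrK.
Qed.

Lemma complete_quotientS (R : realType) (x : R) j :
  complete_quotient x j.+1 = complete_quotient (frac_part x)^-1 j.
Proof. by rewrite /complete_quotient iterSr. Qed.

Lemma convergentS (R : realType) (x : R) j :
  convergent x j.+1
  = (Num.floor x)%:~R + (convergent (frac_part x)^-1 j)^-1.
Proof.
rewrite /convergent /=; congr (_ + (cf_eval _ _)^-1).
rewrite (iotaDl 1 1) -map_comp; apply: eq_map => i /=.
by rewrite /partial_quotient add1n complete_quotientS.
Qed.

(* [h / k] and [h0 / k0] are two consecutive convergents, and [z] is the next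
   complete quotient. *)
Lemma convergent_mobius (R : realType) (j : nat) (x : R) : irrational x ->
  let z := complete_quotient x j.+1 in
  exists h k h0 k0 : int, [/\ 0 < k /\ 0 <= k0,
    1 <= x -> 0 < h /\ 0 <= h0,
    h * k0 - k * h0 = 1 \/ h * k0 - k * h0 = -1,
    convergent x j = h%:~R / k%:~R /\
    convergent x j.+1 = (h * Num.floor z + h0)%:~R / (k * Num.floor z + k0)%:~R &
    x * (k%:~R * z + k0%:~R) = h%:~R * z + h0%:~R ].
Proof.
elim: j x => [|j IH] x ix z.
  have f0 := frac_part_irrational_gt0 R x ix.
  have /andP[_ f1] := frac_part_bounds R x.
  have c1 : 1 <= Num.floor (frac_part x)^-1.
    by rewrite -gtz0_ge1 floor_gt0 ltW// invf_gt1.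
  (* The predecessor of the convergent [floor x / 1] is the formal fraction [1 / 0]; hence [k0] is
     only asked to be non-negative. *)
  exists (Num.floor x), 1, 1, 0; split => //.
  - by move=> x1; split => //; rewrite floor_gt0.
  - by right; lia.
  - split; first by rewrite /convergent /= divr1.
    rewrite convergentS /convergent /= /partial_quotient /complete_quotient /=.
    set c := Num.floor _ in c1 *.
    have cn0 : (c%:~R : rat) != 0 by rewrite intr_eq0; lia.
    by rewrite mul1r addr0 intrD intrM; field.
  - have -> : z = (frac_part x)^-1 by [].
    have {1}-> : x = (Num.floor x)%:~R + frac_part x by rewrite /frac_part; ring.
    by field; rewrite gt_eqF.
have := IH _ (irrational_frac_partV R x ix); cbv zeta.
rewrite -complete_quotientS -/z.
move=> [h [k [h0 [k0 [[k_gt0 k0_ge0] hpos det [cj cj1] zE]]]]].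
have f0 := frac_part_irrational_gt0 R x ix.
have /andP[_ f1] := frac_part_bounds R x.
(* The numerators of the tail become the denominators of [x]. Their signs are claimed only from
   [1 <= x] on, since the first numerator of a number in (0, 1) is 0; the tail exceeds 1. *)
have [h_gt0 h0_ge0] : 0 < h /\ 0 <= h0.
  by apply: hpos; rewrite ltW// invf_gt1.
have z_gt1 : 1 < z.
  rewrite /z /complete_quotient iterS.
  have : irrational (iter j.+1 (fun x => (frac_part x)^-1) x).
    by elim: j.+1 => //= n; exact: irrational_frac_partV.
  set w := iter _ _ _ => iw.
  rewrite invf_gt1; first by have /andP[] := frac_part_bounds R w.
  exact: frac_part_irrational_gt0.
have c_gt0 : 0 < Num.floor z by rewrite floor_gt0 ltW.
set a := Num.floor x.
set c := Num.floor z in cj1 c_gt0 *.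
(* Prepending the digit [a] multiplies the matrix with rows [(h, h0)] and [(k, k0)] on the left by
   the one with rows [(a, 1)] and [(1, 0)], which flips the sign of the determinant. *)
exists (a * h + k), h, (a * h0 + k0), h0; split => //.
- move=> x1; have : 0 < a by rewrite floor_gt0.
  by split; nia.
- by case: det => det; [right|left]; lia.
- have num_gt0 : 0 < h * c + h0 by nia.
  have den_gt0 : 0 < k * c + k0 by nia.
  rewrite [convergent x j.+1]convergentS [convergent x j.+2]convergentS cj cj1.
  have h_neq0 : (h%:~R : rat) != 0 by rewrite intr_eq0 gt_eqF.
  have k_neq0 : (k%:~R : rat) != 0 by rewrite intr_eq0 gt_eqF.
  move: num_gt0 den_gt0; rewrite -!(ltr0z rat) !(intrD, intrM).
  by move=> /lt0r_neq0 H1 /lt0r_neq0 H2; rewrite -/a; split; field; apply/andP.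
- have z_gt0 : 0 < z by rewrite (lt_trans _ z_gt1).
  have {1}-> : x = a%:~R + frac_part x by rewrite /frac_part; ring.
  have fz : frac_part x * (h%:~R * z + h0%:~R) = k%:~R * z + k0%:~R.
    by rewrite -zE mulrA mulfV ?mul1r// gt_eqF.
  by rewrite mulrDl fz !(intrD, intrM); ring.
Qed.

(** The Moebius relation gives the exact error [1 / (k * (k * z + k0))]; replacing [z] by its floor
    can only decrease the second factor and turns it into the next denominator. *)
Lemma convergent_approx (R : realType) (x : R) (j : nat) : irrational x ->
  let q := convergent_den x j in let q' := convergent_den x j.+1 in
  exists a : int, [/\ 0 < q, 0 < q', coprimez a q &
    `|x - a%:~R / q%:~R| <= (q%:~R * q'%:~R)^-1].
Proof.
move=> ix /=; have [h [k [h0 [k0 /= [[k_gt0 k0_ge0] _ det [cj cj1] zE]]]]] :=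
  convergent_mobius R j x ix.
set z := complete_quotient x j.+1 in cj cj1 zE.
have z_gt1 : 1 < z.
  rewrite /z /complete_quotient iterS.
  have : irrational (iter j (fun x => (frac_part x)^-1) x).
    by elim: {+}j => //= n; exact: irrational_frac_partV.
  set w := iter _ _ _ => iw.
  rewrite invf_gt1; first by have /andP[] := frac_part_bounds R w.
  exact: frac_part_irrational_gt0.
set c := Num.floor z in cj cj1.
have c_gt0 : 0 < c by rewrite floor_gt0 ltW.
have kc_gt0 : 0 < k * c + k0 by nia.
have -> : convergent_den x j = k.
  by rewrite /convergent_den cj; apply: (@denq_unimodular _ _ h0 k0).
have -> : convergent_den x j.+1 = k * c + k0.
  rewrite /convergent_den cj1; apply: (@denq_unimodular _ _ h k) => //.
  by case: det => det; [right|left]; lia.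
exists h; split => //.
  by apply/coprimezP; case: det => det;
    [exists (k0, - h0)|exists (- k0, h0)] => /=; lia.
have k_gt0' : 0 < (k%:~R : R) by rewrite ltr0z.
have kc_gt0' : 0 < ((k * c + k0)%:~R : R) by rewrite ltr0z.
have le_kz : (k * c + k0)%:~R <= k%:~R * z + k0%:~R.
  by rewrite intrD intrM lerD2r ler_pM2l// floor_le.
have kz_gt0 := lt_le_trans kc_gt0' le_kz.
have -> : x - h%:~R / k%:~R = (h0 * k - h * k0)%:~R / (k%:~R * (k%:~R * z + k0%:~R)).
  have -> : x = (h%:~R * z + h0%:~R) / (k%:~R * z + k0%:~R).
    by rewrite -zE mulfK ?gt_eqF.
  by rewrite !(intrB, intrM); field; rewrite !gt_eqF.
rewrite normrM normfV [X in _ / X]gtr0_norm ?mulr_gt0//.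
have -> : `|(h0 * k - h * k0)%:~R| = 1 :> R.
  have -> : h0 * k - h * k0 = - (h * k0 - k * h0) by ring.
  by case: det => ->; rewrite ?opprK ?normr1 ?intrN ?normrN1.
by rewrite mul1r lef_pV2 ?posrE ?mulr_gt0// ler_pM2l.
Qed.

(** * A logarithmic form of Stirling's formula *)

Lemma le_of_derive_ge0 (R : realType) (f df : R -> R) :
  (forall x : R, 0 <= x -> is_derive x 1 f (df x)) -> (forall x : R, 0 <= x -> 0 <= df x) ->
  forall x : R, 0 <= x -> f 0 <= f x.
Proof.
move=> fdf df0 x x0; apply: (@ger0_derive1_ndecr R f 0 x) => //.
- by move=> y; rewrite in_itv/= => /andP[/ltW y0 _]; have [] := fdf y y0.
- move=> y; rewrite in_itv/= => /andP[/ltW y0 _]; have fy := fdf y y0.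
  by rewrite derive1E derive_val df0.
- apply: derivable_within_continuous => y; rewrite in_itv/= => /andP[y0 _].
  by have [] := fdf y y0.
Qed.

Lemma is_derive_ln1D (R : realType) (x : R) : 0 < 1 + x ->
  is_derive x 1 (fun y : R => ln (1 + y)) (1 + x)^-1.
Proof.
move=> x1; have dln := is_derive1_ln x1.
have d1 : is_derive x (1 : R) (fun y : R => 1 + y) 1.
  by apply: is_derive_eq; ring.
have := @is_derive1_comp R (@ln R) (fun y => 1 + y) x _ _ dln d1.
by rewrite mulr1.
Qed.

(** Orders two and three are needed here and in the next lemma: [ln (1 + q^-1)] will be multiplied
    by [q + 1], and the remaining error has to be [O(q^-2)] in order to be summable. *)
Lemma ln1D_ge (R : realType) (x : R) : 0 <= x -> x - x ^+ 2 / 2 <= ln (1 + x).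
Proof.
move=> x0; rewrite -subr_ge0.
pose f (y : R) := ln (1 + y) - (y - y ^+ 2 / 2).
have -> : 0 = f 0 by rewrite /f addr0 ln1; ring.
apply: (@le_of_derive_ge0 R f (fun y => y ^+ 2 / (1 + y))) => [y y0|y y0|];
  [|by rewrite divr_ge0 ?sqr_ge0// addr_ge0|exact: x0].
have y1 : 0 < 1 + y by rewrite ltr_wpDr.
have := is_derive_ln1D R y y1 => dln.
have dp : is_derive y (1 : R) (fun y : R => y - y ^+ 2 / 2) (1 - y).
  by apply: is_derive_eq; rewrite ?scaler0 ?scale0r ?addr0 /GRing.scale/=; field.
by apply: (is_derive_eq (is_deriveB dln dp)); field; rewrite gt_eqF.
Qed.

Lemma ln1D_le (R : realType) (x : R) :
  0 <= x -> ln (1 + x) <= x - x ^+ 2 / 2 + x ^+ 3 / 3.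
Proof.
move=> x0; rewrite -subr_ge0.
pose f (y : R) := (y - y ^+ 2 / 2 + y ^+ 3 / 3) - ln (1 + y).
have -> : 0 = f 0 by rewrite /f addr0 ln1; ring.
apply: (@le_of_derive_ge0 R f (fun y => y ^+ 3 / (1 + y))) => [y y0|y y0|];
  [|by rewrite divr_ge0 ?exprn_ge0// addr_ge0|exact: x0].
have y1 : 0 < 1 + y by rewrite ltr_wpDr.
have := is_derive_ln1D R y y1 => dln.
have dp : is_derive y (1 : R) (fun y : R => y - y ^+ 2 / 2 + y ^+ 3 / 3)
    (1 - y + y ^+ 2).
  by apply: is_derive_eq; rewrite ?scaler0 ?scale0r ?addr0 /GRing.scale/=; field.
by apply: (is_derive_eq (is_deriveB dp dln)); field; rewrite gt_eqF.
Qed.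
(* [gamma_log v q] is the logarithm of [e^q * prod_(i < q) (v + i) / q^q]; by
   Stirling's formula it is [(v - 1/2) * ln q + O(1)]. *)
Definition gamma_log (R : realType) (v : R) (q : nat) : R :=
  q%:R + \sum_(i < q) ln (v + i%:R) - q%:R * ln q%:R.

Lemma gamma_logS (R : realType) (v : R) (q : nat) : 0 <= v -> (0 < q)%N ->
  gamma_log R v q.+1 - gamma_log R v q =
  1 + ln (1 + v * q%:R^-1) - (q%:R + 1) * ln (1 + q%:R^-1).
Proof.
move=> v0 q0; have q0' : 0 < (q%:R : R) by rewrite ltr0n.
have vq : 0 < 1 + v * q%:R^-1 by rewrite ltr_wpDr// divr_ge0// ltW.
have q1 : 0 < 1 + (q%:R^-1 : R) by rewrite ltr_wpDr// invr_ge0 ltW.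
have -> : ln (1 + v * q%:R^-1) = ln (v + q%:R) - ln q%:R.
  by rewrite -ln_div ?posrE ?ltr_wpDl//; congr ln; field; rewrite gt_eqF.
have -> : ln (1 + q%:R^-1) = ln q.+1%:R - ln q%:R :> R.
  rewrite -ln_div ?posrE ?ltr0n// -natr1; congr ln; field; rewrite gt_eqF//.
by rewrite /gamma_log big_ord_recr/= -natr1; ring.
Qed.

(** By [gamma_logS] the increments of [gamma_log] are [(v - 1/2) / q + O(q^-2)], like those of
    [(v - 1/2) * ln q], and the errors add up to a constant. *)
Lemma gamma_log_ge (R : realType) (v : R) (q : nat) : 2^-1 <= v <= 1 -> (0 < q)%N ->
  (v - 2^-1) * ln q%:R - 2 <= gamma_log R v q.
Proof.
move=> /andP[v12 v1] q0.
(* The extra [2 / q] closes the induction: its drop from [q] to [q + 1] is at least [q^-2] and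
   absorbs the second order errors. At [q = 1] the claim is [0 <= 1 + ln v]. *)
suff h : (v - 2^-1) * ln q%:R - 2 + 2 / q%:R <= gamma_log R v q.
  by apply: le_trans h; rewrite lerDl divr_ge0.
have v0 : 0 < v by lra.
elim: q q0 => // -[_ _|q IH _].
  rewrite /gamma_log big_ord1 ln1 !addr0 !mulr0 divr1.
  have : - ln v <= 1.
    rewrite -lnV ?posrE//; have := @le_ln1Dx R (v^-1 - 1).
    have := invr_gt0 v; rewrite v0 => vV0.
    have : v^-1 <= 2 by rewrite -[X in _ <= X]invrK lef_pV2 ?posrE ?invr_gt0.
    rewrite (_ : 1 + (v^-1 - 1) = v^-1); last by ring.
    move=> h1 h2.
    by apply: le_trans (h2 _) _; lra.
  by rewrite mulr1n; lra.
have := IH isT; have := gamma_logS R v q.+1 (ltW v0) isT.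
have q0 : 0 < (q.+1%:R : R) by rewrite ltr0n.
have q1 : 1 <= (q.+1%:R : R) by rewrite ler1n.
rewrite -(natr1 q.+1).
move: (q.+1%:R : R) q0 q1 => Q Q0 Q1.
have -> : ln (Q + 1) = ln Q + ln (1 + Q^-1) :> R.
  rewrite -lnM ?posrE ?addr_gt0 ?invr_gt0//; congr ln; by field; rewrite gt_eqF.
have -> : 2 / (Q + 1) = 2 * (Q^-1 / (1 + Q^-1)) :> R.
  by field; apply/andP; split; apply: lt0r_neq0; lra.
have -> : (Q + 1 : R) * ln (1 + Q^-1) = ((Q^-1)^-1 + 1) * ln (1 + Q^-1).
  by rewrite invrK.
have : 0 < (Q^-1 : R) by rewrite invr_gt0.
have : (Q^-1 : R) <= 1 by rewrite invf_le1.
move: (Q^-1 : R) => x x1 x0.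
have h1 := ln1D_ge R (v * x) (mulr_ge0 (ltW v0) (ltW x0)).
have h2 := ln1D_le R x (ltW x0).
have h3 : ln (1 + x) <= x by apply: le_ln1Dx; lra.
have h4 : (x^-1 + 1) * ln (1 + x) <= (x^-1 + 1) * (x - x ^+ 2 / 2 + x ^+ 3 / 3).
  by rewrite ler_pM2l// addr_gt0// invr_gt0.
have h5 : (x^-1 + 1) * (x - x ^+ 2 / 2 + x ^+ 3 / 3) =
   1 + x / 2 - x ^+ 2 / 6 + x ^+ 3 / 3.
  by field; rewrite gt_eqF.
have h6 : (v - 2^-1) * ln (1 + x) <= (v - 2^-1) * x by rewrite ler_wpM2l// subr_ge0.
have h7 : x ^+ 2 / 2 <= x - x / (1 + x).
  have -> : x - x / (1 + x) = x ^+ 2 / (1 + x) by field; lra.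
  by rewrite ler_wpM2l ?sqr_ge0// lef_pV2 ?posrE; lra.
have h8 : x ^+ 3 <= x ^+ 2 by rewrite exprS -[leRHS]mul1r ler_wpM2r// sqr_ge0.
have h9 : (v * x) ^+ 2 <= x ^+ 2.
  by rewrite exprMn -[leRHS]mul1r ler_wpM2r ?sqr_ge0// expr_le1// ltW.
have h10 := sqr_ge0 x.
rewrite expr2 in h7 h8 h9 h10 h1 h5.
move=> h11 h12.
lra.
Qed.

(** The same induction with the correction [- 2 / q]. On this side of 1/2, it is [2^-1 - v] that can
    multiply [ln (1 + x) <= x]. *)
Lemma gamma_log_le (R : realType) (v : R) (q : nat) : 0 < v <= 2^-1 -> (0 < q)%N ->
  gamma_log R v q <= (v - 2^-1) * ln q%:R + 3.
Proof.
move=> /andP[v0 v12] q0.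
suff h : gamma_log R v q <= (v - 2^-1) * ln q%:R + 3 - 2 / q%:R.
  by apply: le_trans h _; rewrite gerBl divr_ge0.
elim: q q0 => // -[_ _|q IH _].
  rewrite /gamma_log big_ord1 ln1 !addr0 !mulr0 divr1.
  have : ln v <= 0 by rewrite ln_le0//; lra.
  by rewrite mulr1n; lra.
have := IH isT; have := gamma_logS R v q.+1 (ltW v0) isT.
have q0 : 0 < (q.+1%:R : R) by rewrite ltr0n.
have q1 : 1 <= (q.+1%:R : R) by rewrite ler1n.
rewrite -(natr1 q.+1).
move: (q.+1%:R : R) q0 q1 => Q Q0 Q1.
have -> : ln (Q + 1) = ln Q + ln (1 + Q^-1) :> R.
  by rewrite -lnM ?posrE ?addr_gt0 ?invr_gt0//; congr ln; field; rewrite gt_eqF.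
have -> : 2 / (Q + 1) = 2 * (Q^-1 / (1 + Q^-1)) :> R.
  by field; apply/andP; split; apply: lt0r_neq0; lra.
have -> : (Q + 1 : R) * ln (1 + Q^-1) = ((Q^-1)^-1 + 1) * ln (1 + Q^-1).
  by rewrite invrK.
have : 0 < (Q^-1 : R) by rewrite invr_gt0.
have : (Q^-1 : R) <= 1 by rewrite invf_le1.
move: (Q^-1 : R) => x x1 x0.
have h1 : ln (1 + v * x) <= v * x by apply: le_ln1Dx; have := mulr_gt0 v0 x0; lra.
have h2 := ln1D_ge R x (ltW x0).
have h3 : ln (1 + x) <= x by apply: le_ln1Dx; lra.
have h4 : (x^-1 + 1) * (x - x ^+ 2 / 2) <= (x^-1 + 1) * ln (1 + x).
  by rewrite ler_pM2l// addr_gt0// invr_gt0.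
have h5 : (x^-1 + 1) * (x - x ^+ 2 / 2) = 1 + x / 2 - x ^+ 2 / 2.
  by field; rewrite gt_eqF.
have h6 : (2^-1 - v) * ln (1 + x) <= (2^-1 - v) * x by rewrite ler_wpM2l// subr_ge0.
have h7 : x ^+ 2 / 2 <= x - x / (1 + x).
  have -> : x - x / (1 + x) = x ^+ 2 / (1 + x) by field; lra.
  by rewrite ler_wpM2l ?sqr_ge0// lef_pV2 ?posrE; lra.
have h10 := sqr_ge0 x.
rewrite expr2 in h7 h10 h5.
move=> h11 h12.
lra.
Qed.

(** * Blocks of an almost periodic orbit *)

Lemma expR_gamma_log (R : realType) (v : R) (q : nat) : 0 < v -> (0 < q)%N ->
  expR 1 ^+ q * \prod_(i < q) ((v + i%:R) / q%:R) = expR (gamma_log R v q).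
Proof.
move=> v0 q0; have q0' : 0 < (q%:R : R) by rewrite ltr0n.
rewrite /gamma_log expRB expRD expR_sum -expRM_natr mul1r -mulrA.
rewrite big_split/= prodr_const card_ord expRM_natl lnK ?posrE// -exprVn.
congr (_ * (_ * _)); apply: eq_bigr => i _.
by rewrite lnK ?posrE// ltr_wpDr.
Qed.

Lemma residue_inj (a k : int) (q : nat) : coprimez a q ->
  {in [pred i : nat | (i < q)%N] &,
    injective (fun i : nat => ((k + i%:Z * a) %% q%:Z)%Z)}.
Proof.
move=> caq i j; rewrite !inE => iq jq /= /eqP.
rewrite eqz_mod_dvd opprD addrACA subrr add0r -mulrBl Gauss_dvdzl; last first.
  by rewrite coprimez_sym.
move=> /dvdzP[m mE].
have m0 : m = 0 by nia.
by move: mE; rewrite m0 mul0r; lia.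
Qed.

(* As [i] runs over a period of length [q], the points [x + i * alpha] modulo 1
   are perturbations of the points [(u + r) / q], [r < q], taken in some order. *)
Lemma frac_part_block (R : realType) (alpha x u zeta : R) (a k : int) (q : nat) :
  coprimez a q ->
  `|q%:R * x - u - k%:~R| + q%:R * `|q%:R * alpha - a%:~R| <= zeta ->
  zeta <= u < 1 - zeta ->
  exists2 r : 'I_q -> 'I_q, injective r &
  forall i : 'I_q, (u - zeta + (r i)%:R) / q%:R <= frac_part (x + i%:R * alpha)
    <= (u + zeta + (r i)%:R) / q%:R.
Proof.
move=> caq hz /andP[zu u1].
case: (posnP q) => [q0|q0].
  have noI (i : 'I_q) : False by case: i => m; rewrite q0.
  by exists id => // i; have := noI i.
have q0' : 0 < (q%:R : R) by rewrite ltr0n.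
have rP (i : 'I_q) : (`|((k + i%:Z * a) %% q%:Z)%Z| < q)%N.
  have := @modz_ge0 (k + i%:Z * a) q%:Z; have := @ltz_pmod (k + i%:Z * a) q%:Z; lia.
exists (fun i => Ordinal (rP i)).
  move=> i j /(congr1 val)/= /eqP; rewrite -eqz_nat !gez0_abs ?modz_ge0; try lia.
  by move=> /eqP /(residue_inj a k q caq) h; apply/val_inj/h; rewrite inE ltn_ord.
move=> i /=; set r := ((k + i%:Z * a) %% q%:Z)%Z.
have r0 : 0 <= r by rewrite /r modz_ge0//; lia.
have rq : r <= q%:Z - 1 by rewrite /r; have := @ltz_pmod (k + i%:Z * a) q%:Z; lia.
set m := ((k + i%:Z * a) %/ q%:Z)%Z.
have dE : k + i%:Z * a = m * q%:Z + r := divz_eq _ _.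
clearbody r m.
have -> : (`|r|%N%:R : R) = r%:~R by rewrite -[in RHS](gez0_abs r0).
have r0' : 0 <= (r%:~R : R) by rewrite ler0z.
have rq' : (r%:~R : R) <= q%:R - 1.
  have : (r%:~R : R) <= (q%:Z - 1)%:~R by rewrite ler_int.
  by rewrite (intrB _ q%:Z 1).
(* The total deviation: [q (x + i alpha) = u + theta + (k + i a)], and the integer [k + i a] is
   [m q + r]. *)
set theta := (q%:R * x - u - k%:~R) + i%:R * (q%:R * alpha - a%:~R).
have htheta : `|theta| <= zeta.
  apply: le_trans hz; apply: le_trans (ler_normD _ _) _.
  rewrite lerD2l normrM normr_nat ler_wpM2r// ler_nat; exact/ltnW/ltn_ord.
have E : x + i%:R * alpha = (u + theta + r%:~R) / q%:R + m%:~R.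
  have -> : (r%:~R : R) = k%:~R + i%:R * a%:~R - m%:~R * q%:R.
    have /(congr1 (fun z : int => z%:~R : R)) := dE.
    by rewrite !(intrD, intrM) => {}dE; rewrite -[i%:R]/(i%:Z%:~R) dE; ring.
  by rewrite /theta; field; rewrite gt_eqF.
move: htheta; rewrite ler_norml => /andP[t1 t2].
(* As [u + theta] stays in [0, 1) and [r <= q - 1], the perturbation never carries a point across an
   integer. *)
rewrite E frac_partDz frac_part_small; last first.
  by rewrite divr_ge0 ?(ltW q0')//= ?ltr_pdivrMr// ?mul1r; lra.
by rewrite !ler_pM2r ?invr_gt0//; lra.
Qed.

Lemma prod_frac_part_block (R : realType) (alpha x u zeta : R) (a k : int) (q : nat) :
  coprimez a q ->
  `|q%:R * x - u - k%:~R| + q%:R * `|q%:R * alpha - a%:~R| <= zeta ->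
  zeta < u < 1 - zeta ->
  expR (gamma_log R (u - zeta) q)
    <= expR 1 ^+ q * \prod_(i < q) frac_part (x + i%:R * alpha)
    <= expR (gamma_log R (u + zeta) q).
Proof.
move=> caq hz /andP[zu u1].
have z0 : 0 <= zeta by apply: le_trans hz; rewrite addr_ge0// mulr_ge0.
have [->|q0] := posnP q.
  by rewrite /gamma_log !big_ord0 expr0 !mul0r !addr0 subr0 expR0 mulr1 lexx.
have q0' : 0 < (q%:R : R) by rewrite ltr0n.
have [|r r_inj rP] := @frac_part_block R alpha x u zeta a k q caq hz.
  by rewrite ltW.
rewrite -!expR_gamma_log//; [|lra|lra].
rewrite !ler_pM2l ?exprn_gt0 ?expR_gt0//.
(* An injection of a finite set into itself is a permutation, so the two outer products may be taken
   in the order in which the orbit visits the cells. *)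
rewrite (reindex_inj r_inj) [X in _ && (_ <= X)](reindex_inj r_inj)/=.
apply/andP; split; apply: ler_prod => i _; have /andP[h1 h2] := rP i.
  by rewrite h1 andbT divr_ge0// addr_ge0// subr_ge0 ltW.
by rewrite h2 andbT; have /andP[] := frac_part_bounds R (x + i%:R * alpha).
Qed.

Definition bishop_weight (R : realType) (alpha : R) (n : nat) (x : R) : R :=
  expR 1 ^+ n * \prod_(j < n) frac_part (x + j%:R * alpha).

Lemma bishop_weight_ge0 (R : realType) (alpha : R) (n : nat) (x : R) :
  0 <= bishop_weight R alpha n x.
Proof.
rewrite mulr_ge0 ?exprn_ge0 ?expR_ge0// prodr_ge0// => i _.
by have /andP[] := frac_part_bounds R (x + i%:R * alpha).
Qed.

Lemma bishop_weight_le (R : realType) (alpha : R) (n : nat) (x : R) :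
  bishop_weight R alpha n x <= expR n%:R.
Proof.
rewrite -[n%:R]mulr1 expRM_natl ler_piMr ?exprn_ge0 ?expR_ge0//.
by apply: prodr_ile1 => i _; have /andP[-> /ltW ->] := frac_part_bounds R (x + i%:R * alpha).
Qed.

(** The cocycle identity, by which an orbit is cut into blocks of length [q]. *)
Lemma bishop_weightD (R : realType) (alpha : R) (m n : nat) (x : R) :
  bishop_weight R alpha (m + n) x =
  bishop_weight R alpha m x * bishop_weight R alpha n (x + m%:R * alpha).
Proof.
rewrite /bishop_weight big_split_ord/= exprD.
under [X in _ * (_ * X)]eq_bigr => i _ do rewrite natrD mulrDl addrA.
by ring.
Qed.

(** One [u] serves all blocks: the block starting at index [l q] has the integer [k + l q a] in
    place of [k], and its starting point has drifted by [l q (q alpha - a)] after scaling by [q],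
    which [zeta] has to cover. *)
Lemma bishop_weight_blocks (R : realType) (alpha x u zeta : R) (a k : int) (q m : nat) :
  coprimez a q ->
  `|q%:R * x - u - k%:~R| + (m * q)%:R * `|q%:R * alpha - a%:~R| <= zeta ->
  zeta < u < 1 - zeta ->
  expR (m%:R * gamma_log R (u - zeta) q) <= bishop_weight R alpha (m * q) x
    <= expR (m%:R * gamma_log R (u + zeta) q).
Proof.
move=> caq + hu; elim: m => [|m IH] hz.
  by rewrite mul0n /bishop_weight big_ord0 !mul0r expR0 expr0 mulr1 lexx.
have D0 : 0 <= `|q%:R * alpha - a%:~R| by [].
have /andP[IH1 IH2] : expR (m%:R * gamma_log R (u - zeta) q)
    <= bishop_weight R alpha (m * q) x <= expR (m%:R * gamma_log R (u + zeta) q).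
  apply: IH; apply: le_trans hz; rewrite lerD2l ler_wpM2r// ler_nat.
  by rewrite leq_mul2r leqnSn orbT.
have /andP[h1 h2] : expR (gamma_log R (u - zeta) q)
    <= bishop_weight R alpha q (x + (m * q)%:R * alpha) <= expR (gamma_log R (u + zeta) q).
  apply: (@prod_frac_part_block R alpha _ u zeta a (k + (m * q)%:Z * a) q) => //.
  apply: le_trans hz; rewrite mulSnr [in leRHS]natrD [in leRHS]mulrDl addrA lerD2r.
  have -> : q%:R * (x + (m * q)%:R * alpha) - u - (k + (m * q)%:Z * a)%:~R =
     (q%:R * x - u - k%:~R) + (m * q)%:R * (q%:R * alpha - a%:~R).
    by rewrite intrD intrM -[(m * q)%:R]/((m * q)%:Z%:~R); ring.
  by apply: le_trans (ler_normD _ _) _; rewrite lerD2l normrM normr_nat.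
have expRS g : expR (m.+1%:R * g) = expR (m%:R * g) * expR g :> R.
  by rewrite -natr1 mulrDl mul1r expRD.
rewrite mulSnr bishop_weightD !expRS.
by apply/andP; split; apply: ler_pM; rewrite ?expR_ge0 ?bishop_weight_ge0.
Qed.

(** An incomplete block may contain a very small factor, so for a lower bound [n] is rounded up to a
    multiple of [q]; the at most [q] additional factors are put in front and weigh at most [e^q].
    The orbit ends near [s] instead of starting there: its starting point is displaced already,
    whence the factor 2 before the drift. *)
Lemma bishop_weight_forward (R : realType) (alpha s u zeta : R) (a k : int) (q n : nat) :
  (0 < q)%N -> coprimez a q -> q%:R * s = u + k%:~R ->
  2 * ((n %/ q).+1 * q)%:R * `|q%:R * alpha - a%:~R| <= zeta ->
  zeta < u < 1 - zeta ->
  expR ((n %/ q).+1%:R * gamma_log R (u - zeta) q - q%:R)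
    <= bishop_weight R alpha n (s - n%:R * alpha).
Proof.
move=> q0 caq sE hz hu; set m := (n %/ q).+1.
have nm : (n <= m * q)%N by rewrite ltnW// ltn_ceil.
have mnq : (m * q - n <= q)%N by rewrite /m mulSn {2}(divn_eq n q); lia.
have /(@bishop_weight_blocks R alpha (s - (m * q)%:R * alpha) u zeta a
    (k - (m * q)%:Z * a) q m caq)/(_ hu)/andP[+ _] :
    `|q%:R * (s - (m * q)%:R * alpha) - u - (k - (m * q)%:Z * a)%:~R|
    + (m * q)%:R * `|q%:R * alpha - a%:~R| <= zeta.
  have -> : q%:R * (s - (m * q)%:R * alpha) - u - (k - (m * q)%:Z * a)%:~R =
     - ((m * q)%:R * (q%:R * alpha - a%:~R)).
    by rewrite intrD intrN intrM -[(m * q)%:R]/((m * q)%:Z%:~R) mulrBr sE; ring.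
  by rewrite normrN normrM normr_nat; move: hz; rewrite -/m; lra.
have -> : bishop_weight R alpha (m * q) (s - (m * q)%:R * alpha) =
    bishop_weight R alpha (m * q - n) (s - (m * q)%:R * alpha) *
    bishop_weight R alpha n (s - (m * q)%:R * alpha + (m * q - n)%:R * alpha).
  by rewrite -bishop_weightD subnK.
move=> /le_trans h; rewrite expRB ler_pdivrMr ?expR_gt0// [leRHS]mulrC; apply: h.
have -> : s - (m * q)%:R * alpha + (m * q - n)%:R * alpha = s - n%:R * alpha.
  by rewrite natrB//; ring.
rewrite ler_wpM2r ?bishop_weight_ge0//.
by rewrite (le_trans (bishop_weight_le _ _ _ _))// ler_expR ler_nat.
Qed.

(** For an upper bound [n] is rounded down, and the remaining factors weigh at most [e^q]. *)
Lemma bishop_weight_backward (R : realType) (alpha s u zeta : R) (a k : int) (q n : nat) :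
  (0 < q)%N -> coprimez a q -> q%:R * s = u + k%:~R ->
  ((n %/ q).+1 * q)%:R * `|q%:R * alpha - a%:~R| <= zeta ->
  zeta < u < 1 - zeta ->
  0 < bishop_weight R alpha n s
    <= expR ((n %/ q)%:R * gamma_log R (u + zeta) q + q%:R).
Proof.
move=> q0 caq sE hz hu; set m := (n %/ q)%N.
have mq_le : (m * q <= n)%N by rewrite leq_divM.
have nmq : (n - m * q <= q)%N by rewrite /m {1}(divn_eq n q) addnC addnK ltnW// ltn_mod.
have nm : (n <= m.+1 * q)%N by rewrite ltnW// ltn_ceil.
have s0 : q%:R * s - u - k%:~R = 0 by rewrite sE; ring.
have blocks (l : nat) : (l <= m.+1)%N ->
    expR (l%:R * gamma_log R (u - zeta) q) <= bishop_weight R alpha (l * q) s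
      <= expR (l%:R * gamma_log R (u + zeta) q).
  move=> lm; apply: (@bishop_weight_blocks R alpha s u zeta a k q l caq) => //.
  rewrite s0 normr0 add0r; apply: le_trans hz.
  by rewrite ler_wpM2r// ler_nat leq_mul2r lm orbT.
apply/andP; split.
  (* Positivity comes from rounding up: the weight of [m + 1] full blocks is positive and has the
     weight of length [n] as a factor. *)
  have /andP[+ _] := blocks m.+1 (leqnn _).
  rewrite -(subnKC nm) bishop_weightD => h.
  rewrite lt_neqAle bishop_weight_ge0 andbT; apply/eqP => W0.
  by move: h; rewrite -W0 mul0r leNgt expR_gt0.
have /andP[_ h] := blocks m (leqnSn _).
rewrite -(subnKC mq_le) bishop_weightD expRD.
apply: ler_pM; rewrite ?bishop_weight_ge0//.
by rewrite (le_trans (bishop_weight_le _ _ _ _))// ler_expR ler_nat.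
Qed.

(** * Measure and norm estimates *)

Lemma lebesgue_measure_translate (R : realType) (c : R) (A : set R) :
  measurable A ->
  lebesgue_measure ((fun x => x + c) @^-1` A) = lebesgue_measure A.
Proof.
move=> mA.
have mf : measurable_fun setT (fun x : R => x + c) by exact: measurable_funD.
change (pushforward lebesgue_measure
  ((fun x : R => x + c) : _ -> measurableTypeR R) A = lebesgue_measure A).
apply/esym/lebesgue_measure_unique => //= _ [[a b] _ <-] /=.
rewrite /pushforward.
have -> : (fun x : R => x + c) @^-1` `]a, b]%classic = `]a - c, b - c]%classic.
  by apply/seteqP; split => x /=; rewrite !in_itv/= ltrBlDr lerBrDr.
by rewrite !lebesgue_measure_itv/= !lte_fin ltrD2r -!EFinB; case: ifP => // _; congr EFin; ring.
Qed.

(** The integral of a non-negative function is a supremum over the simple functions below it, and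
    [g] has more of these than [f]. This applies directly to the iterates, whose measurability is
    not tracked. *)
Lemma le_integral_ge0 d (T : measurableType d) (R : realType)
    (mu : {measure set T -> \bar R}) (f g : T -> \bar R) :
  (forall x, 0 <= f x)%E -> (forall x, f x <= g x)%E ->
  (\int[mu]_x f x <= \int[mu]_x g x)%E.
Proof.
move=> f0 fg; have g0 x : (0 <= g x)%E by apply: le_trans (fg x).
rewrite !ge0_integralTE//; apply: ereal_sup_le => _ [h hf <-].
by exists h => // x; apply: le_trans (fg x).
Qed.

(** Chebyshev's inequality, from comparing the [p]-th power of the modulus with [c ^ p] times the
    indicator of [B]. *)
Lemma Lp_norm_ge (R : realType) (p : R) (f : R -> R[i]) (B : set R) (c k : R) :
  1 <= p -> measurable B -> B `<=` `[0, 1[%classic -> 0 <= c -> 0 <= k ->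
  (forall t, B t -> c <= Normc.normc (f t)) -> (k%:E <= lebesgue_measure B)%E ->
  ((c * k `^ p^-1)%:E <= Lp_norm p f)%E.
Proof.
move=> p1 mB B01 c0 k0 fB kB; rewrite /Lp_norm unlock.
have p0 : 0 < p by lra.
have -> : (c * k `^ p^-1)%:E = (((c `^ p) * k)%:E `^ p^-1)%E.
  by rewrite poweR_EFin powRM ?powR_ge0// -powRrM mulfV ?gt_eqF// powRr1.
apply: gt0_ler_poweR.
- by rewrite invr_ge0 ltW.
- by rewrite in_itv/= leey lee_fin mulr_ge0 ?powR_ge0.
- by rewrite in_itv/= leey integral_ge0// => x _; rewrite poweR_ge0.
apply: (@le_trans _ _ ((c `^ p)%:E * lebesgue_measure B)%E).
  by rewrite EFinM lee_wpmul2l// lee_fin powR_ge0.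
rewrite -(integral_cst lebesgue_measure mB) integral_mkcond.
apply: le_integral_ge0 => x; rewrite patchE; case: ifPn => // xB.
- by rewrite lee_fin powR_ge0.
- move: xB; rewrite inE => xB; rewrite patchE mem_set; last exact: B01.
  rewrite /= lee_fin ge0_ler_powR ?nnegrE ?(ltW p0)//.
  by rewrite (le_trans (fB _ xB))// ler_norm.
- by rewrite poweR_ge0.
Qed.

(** Cutting [A] at [b = frac_part beta] separates the points whose preimage does not wrap around
    from those whose preimage does. On each piece the rotation is a translation, so the measure is
    preserved. *)
Lemma rotation_preimage (R : realType) (beta : R) (A : set R) :
  measurable A -> A `<=` `[0, 1[%classic ->
  exists B : set R, [/\ measurable B, B `<=` `[0, 1[%classic,
    lebesgue_measure B = lebesgue_measure A &
    forall t, B t -> A (frac_part (t + beta))].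
Proof.
move=> mA A01; set b := frac_part beta.
have /andP[b0 b1] : 0 <= b < 1 := frac_part_bounds R beta.
have betaE : beta = b + (Num.floor beta)%:~R by rewrite /b /frac_part subrK.
have mtr (c : R) (D : set R) : measurable D -> measurable ((fun x : R => x + c) @^-1` D).
  move=> mD; rewrite -[X in measurable X]setTI.
  have mf : measurable_fun setT (fun x : R => x + c) by exact: measurable_funD.
  exact: mf.
pose A1 := A `&` `[b, 1[%classic; pose A2 := A `&` `[0, b[%classic.
have mA1 : measurable A1 by exact: measurableI.
have mA2 : measurable A2 by exact: measurableI.
pose B1 := (fun x => x + b) @^-1` A1; pose B2 := (fun x => x + (b - 1)) @^-1` A2.
exists (B1 `|` B2); split.
- by apply: measurableU; exact: mtr.
- move=> t [[/= _]|[/= _]]; rewrite !in_itv/= => /andP[h1 h2];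
    by apply/andP; split; lra.
- rewrite measureU; [|exact: mtr|exact: mtr|]; last first.
    rewrite -subset0 => t [[/= _ +] [/= _]]; rewrite !in_itv/=.
    by move=> /andP[h1 h2] /andP[h3 h4]; lra.
  transitivity (lebesgue_measure A1 + lebesgue_measure A2)%E.
    by congr (_ + _)%E; exact: lebesgue_measure_translate.
  rewrite -measureU//.
    rewrite /A1 /A2 -setIUr; congr (lebesgue_measure _).
    apply/seteqP; split => [t []//|t At]; split => //=.
    have := A01 t At; rewrite /= !in_itv/= => /andP[h1 h2].
    by case: (leP b t) => h3; [left|right]; rewrite ?h1 ?h2.
  rewrite -subset0 => t [[/= _ +] [/= _]]; rewrite !in_itv/=.
  by move=> /andP[h1 h2] /andP[h3 h4]; lra.
- move=> t; rewrite betaE addrA frac_partDz => -[[/= At]|[/= At]].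
    rewrite in_itv/= => /andP[h1 h2]; rewrite frac_part_small//.
    by rewrite (le_trans b0 h1).
  rewrite in_itv/= => /andP[h1 h2].
  have -> : t + b = t + (b - 1) + 1%:~R by ring.
  by rewrite frac_partDz frac_part_small// h1 (lt_trans h2).
Qed.

(* For [0 <= lo <= hi <= 1]: the points [s] of [0, 1[ with [lo <= {q s} < hi]. *)
Definition cells (R : realType) (q : nat) (lo hi : R) : set R :=
  \bigcup_(k in `I_q) `[(k%:R + lo) / q%:R, (k%:R + hi) / q%:R[%classic.

Lemma measurable_cells (R : realType) q (lo hi : R) : measurable (cells R q lo hi).
Proof. by apply: fin_bigcup_measurable => // k _; exact: measurable_itv. Qed.

Lemma cellsP (R : realType) q (lo hi s : R) : (0 < q)%N -> cells R q lo hi s ->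
  exists k : int, exists u : R, q%:R * s = u + k%:~R /\ lo <= u < hi.
Proof.
move=> q0 [k _ /=]; rewrite in_itv/= => /andP[h1 h2].
have q0' : 0 < (q%:R : R) by rewrite ltr0n.
exists k%:Z, (q%:R * s - k%:R); split; first by rewrite -[k%:R]/(k%:Z%:~R) subrK.
move: h1 h2; rewrite ler_pdivrMr// ltr_pdivlMr//.
by rewrite [s * _]mulrC => h1 h2; apply/andP; split; lra.
Qed.

Lemma mem_cells (R : realType) q (s : R) : (0 < q)%N -> 0 <= s < 1 ->
  exists2 u : R, 0 <= u < 1 & forall lo hi, lo <= u < hi -> cells R q lo hi s.
Proof.
move=> q0 /andP[s0 s1].
have q0' : 0 < (q%:R : R) by rewrite ltr0n.
exists (frac_part (q%:R * s)); first exact: frac_part_bounds.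
move=> lo hi /andP[h1 h2].
have qs0 : 0 <= q%:R * s by rewrite mulr_ge0// ltW.
have f0 : 0 <= Num.floor (q%:R * s) by rewrite floor_ge0.
exists `|Num.floor (q%:R * s)|%N.
  rewrite /= -ltz_nat gez0_abs// -(ltr_int R).
  by rewrite (le_lt_trans (floor_le _))// gtr_pMr.
have fE : (`|Num.floor (q%:R * s)|%N%:R : R) = (Num.floor (q%:R * s))%:~R.
  by rewrite -[in RHS](gez0_abs f0).
rewrite /= in_itv/= fE ler_pdivrMr// ltr_pdivlMr//.
by move: h1 h2; rewrite /frac_part [s * _]mulrC => h1 h2; apply/andP; split; lra.
Qed.

Lemma lebesgue_measure_cells (R : realType) q (lo hi : R) : (0 < q)%N -> lo <= hi ->
  (lebesgue_measure (cells R q lo hi) <= (hi - lo)%:E)%E.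
Proof.
move=> q0 lohi; have q0' : 0 < (q%:R : R) by rewrite ltr0n.
apply: (@le_trans _ _ (\sum_(k < q) ((hi - lo) / q%:R)%:E)%E); last first.
  by rewrite sumEFin lee_fin sumr_const card_ord -[leLHS]mulr_natr divfK// gt_eqF.
apply: le_trans.
  apply: (@content_subadditive _ _ _ (@lebesgue_measure R) _
    (fun k : nat => `[(k%:R + lo) / q%:R, (k%:R + hi) / q%:R[%classic : set R) q).
  - by move=> k _; exact: measurable_itv.
  - exact: measurable_cells.
  - by rewrite /cells bigcup_mkord.
apply: lee_sum => k _; rewrite /= lebesgue_measure_itv/=; case: ifPn => [_|_].
  by rewrite -EFinB lee_fin le_eqVlt; apply/orP; left; apply/eqP; field; rewrite gt_eqF.
by rewrite lee_fin divr_ge0 ?subr_ge0.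
Qed.

(** * Moduli and norms of the iterates in terms of the weights *)

Lemma frac_partE (R : realType) (x : R) : frac_part x = x + (- Num.floor x)%:~R.
Proof. by rewrite /frac_part intrN. Qed.

Lemma bishop_weightDz (R : realType) (alpha : R) (n : nat) (x : R) (z : int) :
  bishop_weight R alpha n (x + z%:~R) = bishop_weight R alpha n x.
Proof.
rewrite /bishop_weight; congr (_ * _); apply: eq_bigr => j _.
by rewrite addrAC frac_partDz.
Qed.

Lemma bishop_weight1 (R : realType) (alpha : R) (x : R) :
  bishop_weight R alpha 1 x = expR 1 * frac_part x.
Proof. by rewrite /bishop_weight big_ord1 mul0r addr0 expr1. Qed.

Lemma normc_real (R : realType) (x : R) : 0 <= x -> Normc.normc x%:C = x.
Proof. by move=> x0; rewrite /= expr0n/= addr0 sqrtr_sqr ger0_norm. Qed.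

Lemma normc_bishopt_iter (R : realType) (alpha : R) (n : nat) (f : R -> R[i]) (t : R) :
  0 <= t < 1 -> Normc.normc (iter n (bishopt alpha) f t) =
    bishop_weight R alpha n t * Normc.normc (f (frac_part (t + n%:R * alpha))).
Proof.
elim: n t => [|n IH] t t01.
  by rewrite /bishop_weight big_ord0 expr0 !mul1r mul0r addr0 frac_part_small.
rewrite iterS /bishopt /bishop !Normc.normcM IH; last exact: frac_part_bounds.
rewrite !normc_real ?expR_ge0//; last by case/andP: t01.
rewrite -add1n bishop_weightD bishop_weight1 (frac_part_small _ t)// mul1r.
rewrite [frac_part (t + alpha)]frac_partE bishop_weightDz addrAC frac_partDz.
by rewrite natrD mulrDl mul1r !mulrA addrA.
Qed.

(* There is no exception where a denominator vanishes, because [0^-1 = 0]. *)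
Lemma normc_bishopt_inv_iter (R : realType) (alpha : R) (n : nat) (f : R -> R[i]) (t : R) :
  0 <= t < 1 -> Normc.normc (iter n (bishopt_inv alpha) f t) =
    (bishop_weight R alpha n (t - n%:R * alpha))^-1
    * Normc.normc (f (frac_part (t - n%:R * alpha))).
Proof.
elim: n t => [|n IH] t t01.
  by rewrite /bishop_weight big_ord0 expr0 mul1r invr1 mul1r mul0r subr0 frac_part_small.
have e0 : 0 <= (expR 1 : R)^-1 by rewrite invr_ge0 expR_ge0.
have /andP[f0 _] := frac_part_bounds R (t - alpha).
rewrite iterS /bishopt_inv !Normc.normcM Normc.normcV.
rewrite IH; last exact: frac_part_bounds.
rewrite !normc_real//.
have nE : t - n.+1%:R * alpha = t - alpha - n%:R * alpha by rewrite -natr1; ring.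
rewrite {1}(frac_partE R (t - alpha)) (frac_partE R (t - alpha)) addrAC.
rewrite bishop_weightDz frac_partDz -nE -(frac_partE R (t - alpha)) -addn1 bishop_weightD.
rewrite bishop_weight1 addn1 nE subrK !invfM.
by ring.
Qed.

(** The change of variable [s = frac_part (t + n alpha)] keeps the set [A], on which [f] is large,
    independent of [n]; the weight is then read along the orbit that ends at [s]. *)
Lemma Lp_norm_bishopt_iter_ge (R : realType) (alpha p c k w : R) (n : nat)
    (f : R -> R[i]) (A : set R) :
  1 <= p -> measurable A -> A `<=` `[0, 1[%classic -> 0 <= c -> 0 <= k -> 0 <= w ->
  (forall s, A s -> c <= Normc.normc (f s)) -> (k%:E <= lebesgue_measure A)%E ->
  (forall s, A s -> w <= bishop_weight R alpha n (s - n%:R * alpha)) ->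
  ((w * c * k `^ p^-1)%:E <= Lp_norm p (iter n (bishopt alpha) f))%E.
Proof.
move=> p1 mA A01 c0 k0 w0 fA kA wA.
have [B [mB B01 muB BA]] := @rotation_preimage R (n%:R * alpha) A mA A01.
apply: (@Lp_norm_ge _ _ _ B) => //; [by rewrite mulr_ge0| |by rewrite muB].
move=> t Bt; have t01 : 0 <= t < 1 by have := B01 t Bt; rewrite /= in_itv.
have As := BA t Bt; rewrite normc_bishopt_iter// ler_pM ?fA//.
have := wA _ As; rewrite frac_partE addrAC bishop_weightDz.
by rewrite addrK.
Qed.

(** Here the orbit starts at [s = frac_part (t - n alpha)]. The weight has to be strictly positive,
    because the inverse of 0 is 0 and would spoil the lower bound. *)
Lemma Lp_norm_bishopt_inv_iter_ge (R : realType) (alpha p c k w : R) (n : nat)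
    (f : R -> R[i]) (A : set R) :
  1 <= p -> measurable A -> A `<=` `[0, 1[%classic -> 0 <= c -> 0 <= k -> 0 < w ->
  (forall s, A s -> c <= Normc.normc (f s)) -> (k%:E <= lebesgue_measure A)%E ->
  (forall s, A s -> 0 < bishop_weight R alpha n s <= w^-1) ->
  ((w * c * k `^ p^-1)%:E <= Lp_norm p (iter n (bishopt_inv alpha) f))%E.
Proof.
move=> p1 mA A01 c0 k0 w0 fA kA wA.
have [B [mB B01 muB BA]] := @rotation_preimage R (- (n%:R * alpha)) A mA A01.
apply: (@Lp_norm_ge _ _ _ B) => //; [by rewrite mulr_ge0// ltW| |by rewrite muB].
move=> t Bt; have t01 : 0 <= t < 1 by have := B01 t Bt; rewrite /= in_itv.
have As := BA t Bt; rewrite normc_bishopt_inv_iter// ler_pM ?fA ?(ltW w0)//.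
have := wA _ As; rewrite frac_partE bishop_weightDz => /andP[W0 Ww].
by rewrite -[leLHS]invrK lef_pV2 ?posrE ?invr_gt0.
Qed.

(** The set where [f] does not vanish is the countable union of the level sets [A n] of the squared
    modulus [g], so they cannot all be null. *)
Lemma Lp_nonzero_bounded_below (R : realType) (p : R) (f : R -> R[i]) :
  in_Lp p f -> ~ Lp_zero f ->
  exists c (A : set R), [/\ 0 < c, measurable A, A `<=` `[0, 1[%classic,
    (0 < lebesgue_measure A)%E & forall s, A s -> c <= Normc.normc (f s)].
Proof.
move=> [mRe mIm _] nf0.
pose g (t : R) := (complex.Re (f t)) ^+ 2 + (complex.Im (f t)) ^+ 2.
have mI : measurable (`[0, 1[%classic : set R) by exact: measurable_itv.
have mg : measurable_fun (`[0, 1[%classic : set R) g.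
  by apply: measurable_funD; apply: measurable_funX.
pose A (n : nat) : set R := `[0, 1[%classic `&` g @^-1` `[n.+1%:R^-1, +oo[%classic.
have mA n : measurable (A n) by apply: mg => //; exact: measurable_itv.
have [n An] : exists n, (0 < lebesgue_measure (A n))%E.
  apply: contrapT => /forallNP A0; apply: nf0.
  have negA : lebesgue_measure.-negligible (\bigcup_n A n).
    apply: negligible_bigcup => n; exists (A n); split; [exact: mA| |by []].
    by apply/eqP; rewrite eq_le measure_ge0 andbT leNgt; apply/negP/A0.
  apply: (negligibleS _ negA) => t /= /not_implyP[t01 ft0].
  have g0 : 0 < g t.
    rewrite lt_neqAle addr_ge0 ?sqr_ge0// andbT; apply/eqP => g0; apply: ft0.
    apply: Normc.eq0_normc; move: g0; rewrite /g /Normc.normc.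
    by case: (f t) => a b /= <-; rewrite sqrtr0.
  exists (Num.truncn (g t)^-1) => //; split; first by move: t01; rewrite inE.
  rewrite /= in_itv/= andbT -[leRHS]invrK lef_pV2 ?posrE ?invr_gt0//.
  by rewrite ltW// truncnS_gt.
exists (Num.sqrt n.+1%:R^-1), (A n); split => //.
- by move=> t [].
- move=> t [_] /=; rewrite in_itv/= andbT /g /Normc.normc.
  by case: (f t) => a b /= h; rewrite ler_wsqrtr.
Qed.

(** * Diophantine consequences of not being in M *)

(** Each [q alpha] with [q > 0] has a positive distance to the integers, and only finitely many [q]
    are involved. This will exclude small denominators. *)
Lemma irrational_dist (R : realType) (alpha : R) (Q : nat) : irrational alpha ->
  exists2 d : R, 0 < d &
    forall (q : nat) (a : int), (0 < q < Q)%N -> d <= `|q%:R * alpha - a%:~R|.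
Proof.
move=> ia; elim: Q => [|Q [d d0 IH]]; first by exists 1 => // q a; lia.
have [->|Q0] := posnP Q; first by exists 1 => // q a; lia.
have iQ : irrational (Q%:R * alpha).
  move=> [r _ rE]; apply: ia; exists (r / Q%:R) => //.
  by rewrite fmorph_div/= rE ratr_nat mulrC mulKf// pnatr_eq0 -lt0n.
have f0 := frac_part_irrational_gt0 R _ iQ.
have /andP[_ f1] := frac_part_bounds R (Q%:R * alpha).
exists (Num.min d (Num.min (frac_part (Q%:R * alpha)) (1 - frac_part (Q%:R * alpha)))).
  by rewrite !lt_min d0 f0 subr_gt0.
move=> q a /andP[q0]; rewrite ltnS leq_eqVlt => /orP[/eqP ->|qQ]; last first.
  by rewrite ge_min IH// q0.
rewrite !ge_min; apply/orP; right; move: f0 f1; rewrite /frac_part.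
set x := Q%:R * alpha => f0 f1.
have [h|h] := leP a (Num.floor x); apply/orP; [left|right].
  have : (a%:~R : R) <= (Num.floor x)%:~R by rewrite ler_int.
  by move=> h'; apply: le_trans (ler_norm _); lra.
have : ((Num.floor x)%:~R + 1 : R) <= a%:~R by rewrite -(intrD _ _ 1) ler_int lezD1.
by move=> h'; rewrite distrC; apply: le_trans (ler_norm _); lra.
Qed.

Lemma not_classM_approx (R : realType) (alpha K : R) (Q : nat) :
  0 < alpha < 1 -> irrational alpha -> ~ classM alpha ->
  exists (q : nat) (a : int) (q' : R), [/\ (2 <= q)%N /\ (Q <= q)%N, coprimez a q,
    0 < q', `|q%:R * alpha - a%:~R| <= q'^-1 & K * (q%:R / ln q%:R) < ln q'].
Proof.
move=> a01 ia nM; have [d d0 hd] := irrational_dist R alpha Q ia.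
(* Since [q / ln q >= 1], a failure of the bound with constant [L] also yields [ln q' > - ln d],
   that is [1 / q' < d]; then [irrational_dist] forces [q >= Q]. *)
pose L := Num.max K (Num.max 0 (- ln d)).
have [j [den2 hj]] : exists j, 2 <= convergent_den alpha j /\
    L * ((convergent_den alpha j)%:~R / ln (convergent_den alpha j)%:~R)
    < ln (convergent_den alpha j.+1)%:~R.
  apply: contrapT => /forallNP hn; apply: nM; split => //; exists L => j den2.
  by rewrite leNgt; apply/negP => hlt; apply: (hn j).
have [a []] := convergent_approx R alpha j ia.
move: (convergent_den alpha j.+1) hj => q'.
case: (convergent_den alpha j) den2 => // q den2 hj q_gt0 q'_gt0 caq ha.
have q0 : 0 < (q%:R : R) by rewrite ltr0n.
have q'0 : 0 < (q'%:~R : R) by rewrite ltr0z.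
have hD : `|q%:R * alpha - a%:~R| <= (q'%:~R)^-1.
  have -> : q%:R * alpha - a%:~R = q%:R * (alpha - a%:~R / q%:~R).
    by rewrite -[q%:~R]/(q%:R); field; rewrite gt_eqF.
  rewrite normrM normr_nat mulrC -ler_pdivlMr//; apply: le_trans ha _.
  by rewrite invfM mulrC.
have lnq0 : 0 < ln (q%:R : R) by rewrite ln_gt0// ltr1n.
have ratio1 : 1 <= q%:R / ln (q%:R : R).
  by rewrite ler_pdivlMr// mul1r ltW// ln_sublinear.
have hL (x : R) : x <= L -> x * (q%:R / ln q%:R) < ln q'%:~R.
  move=> xL; apply: le_lt_trans hj; rewrite ler_wpM2r//.
  exact: le_trans ratio1.
exists q, a, q'%:~R; split => //; last by apply: hL; rewrite le_max lexx.
split => //; rewrite leqNgt; apply/negP => qQ.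
have dD : d <= `|q%:R * alpha - a%:~R| by apply: hd; rewrite qQ andbT -ltz_nat.
have : - ln d < ln q'%:~R.
  have L0 : 0 <= L by rewrite !le_max lexx orbT.
  apply: le_lt_trans hj; apply: (@le_trans _ _ L); first by rewrite !le_max lexx !orbT.
  by rewrite -[leLHS]mulr1 ler_wpM2l.
rewrite -lnV ?posrE// ltr_ln ?posrE ?invr_gt0// => hlt.
have := le_trans dD hD; rewrite leNgt => /negP; apply.
by rewrite -[ltRHS]invrK ltf_pV2 ?posrE ?invr_gt0.
Qed.

Lemma sum_inv_ge_ln (R : realType) (m n : nat) : (0 < m)%N -> (0 < n)%N ->
  ln n%:R - ln m%:R <= \sum_(m <= i < n) (i%:R : R)^-1.
Proof.
move=> m0 n0; have [nm|mn] := leqP n m.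
  by rewrite big_geq// subr_le0 ler_ln ?posrE ?ltr0n// ler_nat.
elim: n mn {n0} => // n IH; rewrite ltnS leq_eqVlt => /orP[/eqP <-|mn].
  rewrite big_nat1 -natr1.
  have m0' : 0 < (m%:R : R) by rewrite ltr0n.
  have -> : (m%:R + 1 : R) = m%:R * (1 + m%:R^-1) by field; rewrite gt_eqF.
  have V0 : 0 < (m%:R^-1 : R) by rewrite invr_gt0.
  by rewrite lnM ?posrE ?addr_gt0// addrC addKr le_ln1Dx//; lra.
rewrite big_nat_recr/= ?(ltnW mn)//.
have n0' : 0 < (n%:R : R) by rewrite ltr0n; lia.
have V0 : 0 < (n%:R^-1 : R) by rewrite invr_gt0.
have -> : (n.+1%:R : R) = n%:R * (1 + n%:R^-1) by rewrite -natr1; field; rewrite gt_eqF.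
rewrite lnM ?posrE ?addr_gt0// addrAC lerD ?IH// le_ln1Dx//; lra.
Qed.

(** * Growth of the iterates *)

(** With [zeta = eps], the cells give [u - eps >= 1/2 + eps], so a block gains at least
    [eps ln q - 2], hence [eps / 2 * ln q]. The rounded length is at most [2 n] and the drift counts
    twice, whence [4 n]. *)
Lemma bishop_weight_forward_growth (R : realType) (alpha eps : R) (a : int) (q n : nat) s :
  (0 < q <= n)%N -> coprimez a q -> 0 < eps -> 6 <= eps * ln q%:R ->
  4 * n%:R * `|q%:R * alpha - a%:~R| <= eps ->
  cells R q (2^-1 + 2 * eps) (1 - eps) s ->
  expR ((n%:R / q%:R - 1) * (eps / 2 * ln q%:R) - q%:R)
    <= bishop_weight R alpha n (s - n%:R * alpha).
Proof.
move=> /andP[q0 qn] caq e0 eln hD /(cellsP _ _ _ _ _ q0)[k [u [sE /andP[u1 u2]]]].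
have q0' : 0 < (q%:R : R) by rewrite ltr0n.
have hm : ((n %/ q).+1 * q <= 2 * n)%N.
  by rewrite mulSn; have := leq_divM n q; lia.
have mn : (n%:R / q%:R : R) <= (n %/ q).+1%:R.
  by rewrite ler_pdivrMr// -natrM ler_nat ltnW// ltn_ceil.
apply: le_trans (@bishop_weight_forward R alpha s u eps a k q n q0 caq sE _ _); last 2 first.
- apply: le_trans hD; rewrite ler_wpM2r//.
  have : (((n %/ q).+1 * q)%:R : R) <= (2 * n)%:R by rewrite ler_nat.
  by rewrite natrM; lra.
- by apply/andP; split; lra.
rewrite ler_expR lerD2r.
have hg : eps / 2 * ln q%:R <= gamma_log R (u - eps) q.
  apply: le_trans (@gamma_log_ge R (u - eps) q _ q0); last by apply/andP; split; lra.
  have lnq : 0 <= ln (q%:R : R) by rewrite ln_ge0// ler1n.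
  have : eps * ln (q%:R : R) <= (u - eps - 2^-1) * ln q%:R by rewrite ler_wpM2r//; lra.
  by lra.
apply: ler_pM => //; [|lra|lra].
by rewrite subr_ge0 ler_pdivlMr// mul1r ler_nat.
Qed.

(** Now [u + eps < 1/2 - eps], and the 3 of [gamma_log_le] is absorbed through [6 <= eps * ln q].
    There are at least [n / q - 1] full blocks. *)
Lemma bishop_weight_backward_growth (R : realType) (alpha eps : R) (a : int) (q n : nat) s :
  (0 < q <= n)%N -> coprimez a q -> 0 < eps -> 6 <= eps * ln q%:R ->
  4 * n%:R * `|q%:R * alpha - a%:~R| <= eps ->
  cells R q (2 * eps) (2^-1 - 2 * eps) s ->
  0 < bishop_weight R alpha n s
    <= (expR ((n%:R / q%:R - 1) * (eps / 2 * ln q%:R) - q%:R))^-1.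
Proof.
move=> /andP[q0 qn] caq e0 eln hD /(cellsP _ _ _ _ _ q0)[k [u [sE /andP[u1 u2]]]].
have q0' : 0 < (q%:R : R) by rewrite ltr0n.
have hm : ((n %/ q).+1 * q <= 2 * n)%N.
  by rewrite mulSn; have := leq_divM n q; lia.
have mn : (n%:R / q%:R : R) - 1 <= (n %/ q)%:R.
  by rewrite lerBlDr natr1 ler_pdivrMr// -natrM ler_nat ltnW// ltn_ceil.
have /andP[-> /=] : 0 < bishop_weight R alpha n s
    <= expR ((n %/ q)%:R * gamma_log R (u + eps) q + q%:R).
  apply: (@bishop_weight_backward R alpha s u eps a k q n) => //; last first.
    by apply/andP; split; lra.
  apply: le_trans hD; rewrite ler_wpM2r//.
  have : (((n %/ q).+1 * q)%:R : R) <= (2 * n)%:R by rewrite ler_nat.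
  by rewrite natrM; have : 0 <= (n%:R : R) by []; lra.
move=> /le_trans; apply.
rewrite -expRN ler_expR opprB addrC lerD2l.
have hg : eps / 2 * ln q%:R <= - gamma_log R (u + eps) q.
  have h := @gamma_log_le R (u + eps) q _ q0.
  have {}h : gamma_log R (u + eps) q <= (u + eps - 2^-1) * ln q%:R + 3.
    by apply: h; apply/andP; split; lra.
  have lnq : 0 <= ln (q%:R : R) by rewrite ln_ge0// ler1n.
  have : (u + eps - 2^-1) * ln q%:R <= - eps * ln (q%:R : R) by rewrite ler_wpM2r//; lra.
  by lra.
rewrite lerNr -mulrN; apply: ler_pM => //; [|lra].
by rewrite subr_ge0 ler_pdivlMr// mul1r ler_nat.
Qed.

(* The points that neither the forward nor the backward weights control lie in
   cells of total measure [7 * eps]. *)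
Lemma cells_dichotomy (R : realType) (q : nat) (A : set R) (M : R) :
  (0 < q)%N -> measurable A -> A `<=` `[0, 1[%classic -> 0 < M ->
  lebesgue_measure A = M%:E ->
  let eps := M / 28 in
  ((M / 4)%:E <= lebesgue_measure (A `&` cells R q (2^-1 + 2 * eps) (1 - eps)))%E \/
  ((M / 4)%:E <= lebesgue_measure (A `&` cells R q (2 * eps) (2^-1 - 2 * eps)))%E.
Proof.
move=> q0 mA A01 M0 muA eps.
have M1 : M <= 1.
  have : (lebesgue_measure A <= lebesgue_measure (`[0%R, 1%R[%classic : set R))%E.
    by rewrite le_measure ?inE//; exact: measurable_itv.
  by rewrite muA lebesgue_measure_itv/= lte_fin ltr01 -EFinB subr0 lee_fin.
set F := cells R q (2^-1 + 2 * eps) (1 - eps).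
set B := cells R q (2 * eps) (2^-1 - 2 * eps).
pose C1 := cells R q 0 (2 * eps).
pose C2 := cells R q (2^-1 - 2 * eps) (2^-1 + 2 * eps).
pose C3 := cells R q (1 - eps) 1.
have mc lo hi : measurable (cells R q lo hi) by exact: measurable_cells.
have cover : A `<=` (A `&` F) `|` (A `&` B) `|` (C1 `|` C2 `|` C3).
  move=> s As; have s01 : 0 <= s < 1 by have := A01 s As; rewrite /= in_itv.
  have [u /andP[u0 u1] hu] := mem_cells R q s q0 s01.
  have [h1|h1] := ltP u (2 * eps); first by right; left; left; apply: hu; rewrite u0.
  have [h2|h2] := ltP u (2^-1 - 2 * eps).
    by left; right; split => //; apply: hu; rewrite h1.
  have [h3|h3] := ltP u (2^-1 + 2 * eps); first by right; left; right; apply: hu; rewrite h2.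
  have [h4|h4] := ltP u (1 - eps); first by left; left; split => //; apply: hu; rewrite h3.
  by right; right; apply: hu; rewrite h4.
have mAF : measurable (A `&` F) by apply: measurableI => //; exact: mc.
have mAB : measurable (A `&` B) by apply: measurableI => //; exact: mc.
have mC12 : measurable (C1 `|` C2) by apply: measurableU; exact: mc.
have mC : measurable (C1 `|` C2 `|` C3) by apply: measurableU => //; exact: mc.
have mFB : measurable ((A `&` F) `|` (A `&` B)) by exact: measurableU.
have sub : (M%:E <= lebesgue_measure (A `&` F) + lebesgue_measure (A `&` B) + (7 * eps)%:E)%E.
  rewrite -muA; apply: (@le_trans _ _ (lebesgue_measure
      ((A `&` F) `|` (A `&` B) `|` (C1 `|` C2 `|` C3)))).
    by rewrite le_measure ?inE//; exact: measurableU.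
  apply: le_trans (measureU2 _ _ _) _; [exact: mFB|exact: mC|].
  apply: leeD; first exact: measureU2.
  apply: le_trans (measureU2 _ _ _) _; [exact: mC12|exact: mc|].
  have -> : 7 * eps = 2 * eps + 4 * eps + eps by ring.
  rewrite !EFinD; apply: leeD; last first.
    have -> : eps = 1 - (1 - eps) by ring.
    by apply: lebesgue_measure_cells => //; rewrite /eps; lra.
  apply: le_trans (measureU2 _ _ _) _; [exact: mc|exact: mc|apply: leeD].
    have -> : 2 * eps = 2 * eps - 0 by ring.
    by apply: lebesgue_measure_cells => //; rewrite /eps; lra.
  have -> : 4 * eps = 2^-1 + 2 * eps - (2^-1 - 2 * eps) by ring.
  by apply: lebesgue_measure_cells => //; rewrite /eps; lra.
(* As [7 * eps = M / 4], two intersections of measure below [M / 4] would leave less than [3 M / 4]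
   for [A]. *)
apply/orP; apply/contraT; rewrite negb_or -!ltNge => /andP[hF hB].
move: sub hF hB.
case: (lebesgue_measure (A `&` F)) (measure_ge0 lebesgue_measure (A `&` F)) => // x _.
case: (lebesgue_measure (A `&` B)) (measure_ge0 lebesgue_measure (A `&` B)) => // y _.
rewrite -!EFinD !lte_fin !lee_fin => h1 h2 h3.
by move: h1; rewrite /eps; lra.
Qed.

(** The order of the quantifiers matters: [eps] and [c] are fixed before [q], and the direction [b]
    before [n], which is possible because the cells do not depend on [n]. *)
Lemma bishopt_iter_growth (R : realType) (alpha p : R) (f : R -> R[i]) :
  1 <= p -> in_Lp p f -> ~ Lp_zero f ->
  exists eps c : R, [/\ 0 < eps, 0 < c & forall (q : nat) (a : int),
    (0 < q)%N -> coprimez a q -> 6 <= eps * ln q%:R ->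
    exists b : bool, forall n : nat, (q <= n)%N ->
      4 * n%:R * `|q%:R * alpha - a%:~R| <= eps ->
      ((expR ((n%:R / q%:R - 1) * (eps / 2 * ln q%:R) - q%:R) * c)%:E
        <= Lp_norm p (bishopt_iter alpha (if b then n%:Z else - n%:Z)%R f))%E].
Proof.
move=> p1 hf hf0.
have [c [A [c0 mA A01 muA0 fA]]] := Lp_nonzero_bounded_below R p f hf hf0.
have muA1 : (lebesgue_measure A <= 1)%E.
  apply: (@le_trans _ _ (lebesgue_measure (`[0%R, 1%R[%classic : set R))).
    by rewrite le_measure ?inE//; exact: measurable_itv.
  by rewrite lebesgue_measure_itv/= lte_fin ltr01 -EFinB subr0.
have muAfin : lebesgue_measure A \is a fin_num.
  by rewrite ge0_fin_numE ?measure_ge0// (le_lt_trans muA1)// ltry.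
set M := fine (lebesgue_measure A).
have muA : lebesgue_measure A = M%:E by rewrite fineK.
have M0 : 0 < M by rewrite -lte_fin -muA.
have k0 : 0 < M / 4 by lra.
exists (M / 28), (c * (M / 4) `^ p^-1); split; first by lra.
  by rewrite mulr_gt0// powR_gt0.
move=> q a q0 caq hln.
have mc lo hi : measurable (A `&` cells R q lo hi).
  by apply: measurableI => //; exact: measurable_cells.
have [hk|hk] := @cells_dichotomy R q A M q0 mA A01 M0 muA; [exists true|exists false];
    move=> n qn hD; rewrite mulrA.
  apply: (@Lp_norm_bishopt_iter_ge R alpha p c (M / 4) _ n f _ p1
    (mc (2^-1 + 2 * (M / 28)) (1 - M / 28))) => //;
    rewrite ?expR_ge0 ?(ltW c0) ?(ltW k0)//.
  - by move=> s [/A01].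
  - by move=> s [/fA].
  - move=> s [_]; apply: (@bishop_weight_forward_growth R alpha (M / 28) a q n s) => //.
      by rewrite q0.
    by lra.
(* For [n = 0] the integer lies in the forward branch, where both sides are [f]. *)
have -> : bishopt_iter alpha (- n%:Z) f = iter n (bishopt_inv alpha) f.
  by case: (n) => [|m] //.
apply: (@Lp_norm_bishopt_inv_iter_ge R alpha p c (M / 4) _ n f _ p1
  (mc (2 * (M / 28)) (2^-1 - 2 * (M / 28)))) => //;
  rewrite ?expR_gt0 ?(ltW c0) ?(ltW k0)//.
- by move=> s [/A01].
- by move=> s [/fA].
- move=> s [_]; apply: (@bishop_weight_backward_growth R alpha (M / 28) a q n s) => //.
    by rewrite q0.
  by lra.
Qed.

(** * From growth to the divergence of the logarithmic sum *)

Lemma esum_ge_sum_nat (R : realType) (I : choiceType) (g : I -> \bar R) (e : nat -> I)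
    (m n : nat) : injective e ->
  (\sum_(m <= i < n) g (e i) <= \esum_(x in [set: I]) g x)%E.
Proof.
move=> e_inj; apply: esum_ge; exists [set x | x \in [seq e i | i <- index_iota m n]].
  by split => //; exact: finite_seq.
by rewrite -fsbig_seq ?map_inj_uniq ?iota_uniq// big_map.
Qed.

(** This is [ln y <= y] at [y = sqrt x]; it bounds the loss [(ln q)^2 / q] caused by starting the
    sum at [q^2]. *)
Lemma ln_sqr_le (R : realType) (x : R) : 1 <= x -> ln x ^+ 2 <= 4 * x.
Proof.
move=> x1; have x0 : 0 < x by lra.
have s0 : 0 < Num.sqrt x by rewrite sqrtr_gt0.
have xE : Num.sqrt x ^+ 2 = x by rewrite sqr_sqrtr// ltW.
have lnE : ln x = 2 * ln (Num.sqrt x) by rewrite -{1}xE lnXn// mulr_natl.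
have ln0 : 0 <= ln (Num.sqrt x).
  by have := ln_ge0 x1; rewrite lnE; lra.
have h : ln (Num.sqrt x) <= Num.sqrt x by rewrite ltW// ln_sublinear.
rewrite lnE exprMn -[in leRHS]xE.
have -> : (2 : R) ^+ 2 = 4 by ring.
by rewrite ler_wpM2l// lerXn2r ?nnegrE// ltW.
Qed.

Lemma bishopt_term_ge (R : realType) (p c lam : R) (q n : nat) (X : \bar R) :
  0 < c -> (4 <= q)%N -> (q ^ 2 <= n)%N -> 4 * (1 + `|ln c|) <= lam ->
  ((expR ((n%:R / q%:R - 1) * lam - q%:R) * c)%:E <= X)%E ->
  ((lam / (4 * q%:R) * n%:R^-1)%:E <= lne (1 + X) / (1 + n%:R ^+ 2)%:E)%E.
Proof.
move=> c0 q4 qn hlam hX.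
have q4' : 4 <= (q%:R : R) by rewrite (ler_nat _ 4).
have q0 : 0 < (q%:R : R) by lra.
have n0 : 0 < (n%:R : R) by rewrite ltr0n; nia.
have n1 : 1 <= (n%:R : R) by rewrite ler1n; nia.
have nq : q%:R <= (n%:R / q%:R : R).
  by rewrite ler_pdivlMr// -natrM ler_nat; move: qn; rewrite expnS expn1.
set E := (n%:R / q%:R - 1) * lam - q%:R in hX *.
have lnc : - ln c <= `|ln c| by rewrite -normrN ler_norm.
(* Half of [lam * n / q] is kept. Since [n / q >= q], the other half is at least [lam * q / 2]: one
   quarter [lam * q / 4] pays for [lam] as [q >= 4], the other for [q] and [- ln c]. *)
have hE : lam / (2 * q%:R) * n%:R <= E + ln c.
  have -> : lam / (2 * q%:R) * n%:R = lam / 2 * (n%:R / q%:R) by field; rewrite gt_eqF.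
  rewrite /E; move: nq; set r := n%:R / q%:R => nq.
  have c1 : 0 <= `|ln c| by [].
  have h1 : (lam / 2) * q%:R <= (lam / 2) * r by rewrite ler_wpM2l//; lra.
  have h2 : (lam / 4) * 4 <= (lam / 4) * q%:R by rewrite ler_wpM2l//; lra.
  have h3 : (1 + `|ln c|) * q%:R <= (lam / 4) * q%:R by rewrite ler_wpM2r//; lra.
  have h4 : `|ln c| * 1 <= `|ln c| * q%:R by rewrite ler_wpM2l//; lra.
  by lra.
have hln : ((E + ln c)%:E <= lne (1 + X))%E.
  have -> : (E + ln c)%:E = lne (expR E * c)%:E.
    by rewrite lne_EFin ?mulr_gt0 ?expR_gt0// lnM ?posrE ?expR_gt0// expRK.
  have w0 : (0 <= (expR E * c)%:E)%E by rewrite lee_fin mulr_ge0 ?expR_ge0// ltW.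
  have X0 : (0 <= X)%E by apply: le_trans hX.
  rewrite lee_lne ?in_itv/= ?leey ?w0 ?adde_ge0//.
  by apply: le_trans hX _; rewrite leeDr.
have d0 : 0 < 1 + (n%:R : R) ^+ 2 by rewrite ltr_pwDl// sqr_ge0.
rewrite inver gt_eqF//.
apply: le_trans (lee_wpmul2r _ hln); last by rewrite lee_fin invr_ge0 ltW.
rewrite -EFinM lee_fin ler_pdivlMr//.
apply: le_trans hE.
have -> : lam / (2 * q%:R) * n%:R = lam / (4 * q%:R) * (2 * n%:R).
  by field; rewrite gt_eqF.
rewrite -[leLHS]mulrA ler_wpM2l//; first by rewrite divr_ge0//; have := normr_ge0 (ln c); lra.
rewrite mulrC ler_pdivrMr//.
have : 1 <= (n%:R : R) ^+ 2 by rewrite expr_ge1// ltW.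
by rewrite expr2; lra.
Qed.

Theorem theorem4p1 (R : realType) (alpha : R) (halpha : 0 < alpha < 1)
    (hirr : irrational alpha) (hM : ~ classM alpha)
    (p : R) (hp : 1 <= p) (f : R -> R[i]) (hf : in_Lp p f)
    (hf0 : ~ Lp_zero f) :
  (\esum_(n in [set: int])
     (lne (1 + Lp_norm p (bishopt_iter alpha n f)) / (1 + n%:~R ^+ 2)%:E)
   = +oo)%E.
Proof.
have [eps [c [e0 c0 growth]]] := bishopt_iter_growth R alpha p f hp hf hf0.
apply/eqyP => T T0.
(* [K] is chosen so that [eps / 8 * (K - L - 8) = T]: [L] accounts for the factor [eps / 4] in the
   length of the sum, and 8 for [2 * (ln q)^2 / q]. *)
pose L := `|ln (eps / 4)|; pose K := 8 * T / eps + L + 8.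
(* [ln q >= B] provides both [6 <= eps * ln q] and [4 * (1 + |ln c|) <= eps / 2 * ln q]. *)
pose B := (6 + 8 * (1 + `|ln c|)) / eps.
pose Q := (4 + (Num.truncn (expR B)).+1)%N.
have [q [a [q' [[q2 Qq] caq q'0 hD hK]]]] := not_classM_approx R alpha K Q halpha hirr hM.
have q4 : (4 <= q)%N by apply: leq_trans Qq; rewrite leq_addr.
have q0 : (0 < q)%N := ltnW q2.
have q0' : 0 < (q%:R : R) by rewrite ltr0n.
have q1' : 1 <= (q%:R : R) by rewrite ler1n.
have Blnq : B <= ln (q%:R : R).
  rewrite -[B]expRK ler_ln ?posrE ?expR_gt0//.
  apply: le_trans (ltW (truncnS_gt _)) _; rewrite ler_nat.
  by apply: leq_trans Qq; rewrite leq_addl.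
have lnc0 : 0 <= `|ln c| by [].
have epsB : 6 + 8 * (1 + `|ln c|) <= eps * ln q%:R by rewrite [leRHS]mulrC -ler_pdivrMr.
have lnq0 : 0 < ln (q%:R : R) by apply: lt_le_trans Blnq; rewrite divr_gt0//; lra.
have [|b hb] := growth q a q0 caq; first by lra.
(* The indices below [N] are those with [4 * n / q' <= eps], for which the drift is under
   control. *)
pose N := (Num.truncn (eps * q' / 4)).+1.
pose e (n : nat) : int := if b then n%:Z else - n%:Z.
have e_inj : injective e by rewrite /e; case: (b) => i j; [case|move=> /oppr_inj[]].
apply: le_trans (@esum_ge_sum_nat R _ _ e (q ^ 2) N e_inj).
pose lam := eps / 2 * ln (q%:R : R).
apply: (@le_trans _ _ (\sum_(q ^ 2 <= n < N) (lam / (4 * q%:R) * n%:R^-1)%:E)%E); last first.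
  rewrite !big_seq; apply: lee_sum => n; rewrite mem_index_iota => /andP[qn nN].
  have -> : (e n)%:~R ^+ 2 = n%:R ^+ 2 :> R.
    by rewrite /e; case: (b); rewrite ?intrN ?sqrrN.
  apply: (@bishopt_term_ge R p c lam q n) => //; first by rewrite /lam; lra.
  apply: hb; first by apply: leq_trans qn; rewrite -{1}(expn1 q) leq_pexp2l.
  have n_le : n%:R <= eps * q' / 4.
    by rewrite -truncn_ge_nat ?divr_ge0 ?mulr_ge0 ?(ltW e0) ?(ltW q'0).
  apply: (@le_trans _ _ (4 * n%:R * q'^-1)); first by rewrite ler_wpM2l// mulr_ge0.
  by rewrite ler_pdivrMr//; lra.
rewrite sumEFin lee_fin -mulr_sumr.
have lam0 : 0 <= lam / (4 * q%:R) by rewrite divr_ge0 ?mulr_ge0 ?ltW// /lam; lra.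
have q20 : (0 < q ^ 2)%N by rewrite expn_gt0 q0.
(* The bound covers an empty range [N <= q^2] as well, so the two ends need not be compared. *)
apply: le_trans (ler_wpM2l lam0 (@sum_inv_ge_ln R (q ^ 2) N q20 isT)).
have lnN : ln q' - L <= ln N%:R.
  have hN : eps / 4 * q' <= N%:R by rewrite mulrAC ltW// truncnS_gt.
  have : ln (eps / 4 * q') <= ln N%:R by rewrite ler_ln ?posrE ?mulr_gt0 ?divr_gt0// ltr0n.
  rewrite lnM ?posrE ?divr_gt0//; have : - ln (eps / 4) <= L by rewrite /L -normrN ler_norm.
  by lra.
have -> : ln (q ^ 2)%:R = 2 * ln q%:R :> R by rewrite natrX lnXn// mulr_natl.
apply: (@le_trans _ _ (lam / (4 * q%:R) * (ln q' - L - 2 * ln q%:R))); last first.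
  by rewrite ler_wpM2l// lerD2r.
(* In terms of [x] the prefactor [lam / (4 q)] is [eps / 8 * x], and the approximation hypothesis
   [K * (q / ln q) < ln q'] gives [K <= x * ln q']. *)
pose x := ln (q%:R : R) / q%:R.
have x0 : 0 < x by rewrite divr_gt0.
have x1 : x <= 1 by rewrite ler_pdivrMr// mul1r ltW// ln_sublinear.
have -> : lam / (4 * q%:R) * (ln q' - L - 2 * ln q%:R)
    = eps / 8 * (x * ln q' - x * L - 2 * (ln q%:R ^+ 2 / q%:R)).
  by rewrite /lam /x; field; rewrite gt_eqF.
have hx : K <= x * ln q'.
  rewrite mulrC -ler_pdivrMr// ltW//.
  by have -> : K / x = K * (q%:R / ln q%:R) by rewrite /x; field; rewrite !gt_eqF.
have hL : x * L <= L by rewrite (ler_piMl (normr_ge0 _) x1).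
have hsq : ln q%:R ^+ 2 / q%:R <= 4 :> R by rewrite ler_pdivrMr// ln_sqr_le.
have -> : T = eps / 8 * (K - L - 8) by rewrite /K; field; rewrite gt_eqF.
by rewrite ler_wpM2l//; lra.
Qed.
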